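(* Let $i:\mathcal{F}\to\mathcal{E}$ and $i':\mathcal{F}'\to\mathcal{F}$ be geometric inclusions of elementary toposes, with inverse image functors (reflectors) $L:\mathcal{E}\to\mathcal{F}$ and $L':\mathcal{F}\to\mathcal{F}'$, let $j_L$ and $j_{L'}$ be the corresponding local operators on $\mathcal{E}$ and on $\mathcal{F}$ respectively, and let $j_{L'\circ L}$ be the local operator on $\mathcal{E}$ corresponding to the composite inclusion $i\circ i'$. Then $j_{L'}:\Omega_L\to\Omega_L$ is the relativization of $j_{L'\circ L}$ at $j_L$, that is, $e_{j_L}\circ j_{L'}=j_{L'\circ L}\circ e_{j_L}$ as arrows $\Omega_L\to\Omega$ in $\mathcal{E}$.
   Context: $\Omega$ is the subobject classifier of $\mathcal{E}$. For a local operator $j$ on $\mathcal{E}$, $e_j:\Omega_j\rightarrowtail\Omega$ is the equalizer of $1_\Omega,j:\Omega\to\Omega$, and $\Omega_j$ is the subobject classifier of the topos $\mathbf{sh}_j(\mathcal{E})$ of $j$-sheaves. $\Omega_L$ means $\Omega_{j_L}$, and $\mathcal{F}$ is identified with $\mathbf{sh}_{j_L}(\mathcal{E})$, so that $j_{L'}$ is an arrow $\Omega_L\to\Omega_L$. A local operator $k':\Omega_j\to\Omega_j$ on $\mathbf{sh}_j(\mathcal{E})$ is called the relativization at $j$ of a local operator $k$ on $\mathcal{E}$ if $e_j\circ k'=k\circ e_j$. *)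

(* Defs.v *)
From Stdlib Require Import ssreflect ssrfun Setoid.

Set Implicit Arguments.
Unset Strict Implicit.
Unset Printing Implicit Defensive.

Declare Scope cat_scope.
Delimit Scope cat_scope with cat.
Open Scope cat_scope.

Record Category := {
  obj :> Type;
  hom : obj -> obj -> Type;
  idm : forall X, hom X X;
  comp : forall X Y Z, hom Y Z -> hom X Y -> hom X Z;
  comp1m : forall X Y (f : hom X Y), comp (idm Y) f = f;
  compm1 : forall X Y (f : hom X Y), comp f (idm X) = f;
  compA : forall X Y Z W (h : hom Z W) (g : hom Y Z) (f : hom X Y),
    comp (comp h g) f = comp h (comp g f)
}.
Arguments hom {c} _ _.
Arguments idm {c} X.
Arguments comp {c X Y Z} _ _.
Notation "g ∘ f" := (comp g f) (at level 40, left associativity) : cat_scope.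

Record Functor (C D : Category) := {
  fobj :> C -> D;
  fmap : forall X Y : C, hom X Y -> hom (fobj X) (fobj Y);
  fmap1 : forall X, fmap (idm X) = idm (fobj X);
  fmapM : forall X Y Z (g : hom Y Z) (f : hom X Y),
    fmap (g ∘ f) = fmap g ∘ fmap f
}.
Arguments fmap {C D} _ {X Y} _.

Definition functor_comp (C D E : Category) (G : Functor D E) (H : Functor C D) :
  Functor C E.
Proof.
refine {| fobj := fun X => G (H X); fmap := fun X Y f => fmap G (fmap H f) |}.
- by move=> X; rewrite !fmap1.
- by move=> X Y Z g f; rewrite !fmapM.
Defined.

Lemma exists_unique_eq (A : Type) (P : A -> Prop) (u v : A) :
  (exists! x, P x) -> P u -> P v -> u = v.
Proof. by move=> [z [_ U]] Pu Pv; rewrite -(U u) // -(U v). Qed.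

Section CategoryDefs.
Variable C : Category.
Implicit Types X Y Z P : C.

Definition mono X Y (m : hom X Y) :=
  forall W (u v : hom W X), m ∘ u = m ∘ v -> u = v.

Definition is_iso X Y (f : hom X Y) :=
  exists g : hom Y X, g ∘ f = idm X /\ f ∘ g = idm Y.

Definition is_terminal X := forall W, exists! f : hom W X, True.

Definition is_product P X Y (p : hom P X) (q : hom P Y) :=
  forall W (u : hom W X) (v : hom W Y), exists! w : hom W P, p ∘ w = u /\ q ∘ w = v.

Definition is_equalizer P X Y (e : hom P X) (f g : hom X Y) :=
  f ∘ e = g ∘ e /\
  forall W (h : hom W X), f ∘ h = g ∘ h -> exists! w : hom W P, e ∘ w = h.

Definition is_pullback P X Y Z (p : hom P X) (q : hom P Y) (f : hom X Z) (g : hom Y Z) :=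
  f ∘ p = g ∘ q /\
  forall W (u : hom W X) (v : hom W Y), f ∘ u = g ∘ v ->
    exists! w : hom W P, p ∘ w = u /\ q ∘ w = v.

End CategoryDefs.

Definition fully_faithful (C D : Category) (G : Functor C D) :=
  forall (X Y : C) (g : hom (G X) (G Y)), exists! f : hom X Y, fmap G f = g.

Record preserves_finite_limits (C D : Category) (G : Functor C D) : Prop := {
  pres_terminal : forall X, is_terminal X -> is_terminal (G X);
  pres_product : forall (P X Y : C) (p : hom P X) (q : hom P Y),
    is_product p q -> is_product (fmap G p) (fmap G q);
  pres_equalizer : forall (P X Y : C) (e : hom P X) (f g : hom X Y),
    is_equalizer e f g -> is_equalizer (fmap G e) (fmap G f) (fmap G g)
}.

Record Topos := {
  topos_cat :> Category;

  one : topos_cat;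
  bang : forall X, hom X one;
  bang_uniq : forall X (f g : hom X one), f = g;

  prod : topos_cat -> topos_cat -> topos_cat;
  pr1 : forall X Y, hom (prod X Y) X;
  pr2 : forall X Y, hom (prod X Y) Y;
  pair : forall W X Y, hom W X -> hom W Y -> hom W (prod X Y);
  pr1_pair : forall W X Y (u : hom W X) (v : hom W Y), pr1 X Y ∘ pair u v = u;
  pr2_pair : forall W X Y (u : hom W X) (v : hom W Y), pr2 X Y ∘ pair u v = v;
  pair_uniq : forall W X Y (u v : hom W (prod X Y)),
    pr1 X Y ∘ u = pr1 X Y ∘ v -> pr2 X Y ∘ u = pr2 X Y ∘ v -> u = v;

  eqz : forall X Y (f g : hom X Y), topos_cat;
  eqm : forall X Y (f g : hom X Y), hom (eqz f g) X;
  eqm_eq : forall X Y (f g : hom X Y), f ∘ eqm f g = g ∘ eqm f g;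
  eqz_lift : forall X Y (f g : hom X Y) W (h : hom W X),
    f ∘ h = g ∘ h -> hom W (eqz f g);
  eqz_liftK : forall X Y (f g : hom X Y) W (h : hom W X) (H : f ∘ h = g ∘ h),
    eqm f g ∘ eqz_lift H = h;
  eqm_mono : forall X Y (f g : hom X Y), mono (eqm f g);

  exp : topos_cat -> topos_cat -> topos_cat;
  ev : forall A B, hom (prod (exp A B) A) B;
  curry : forall X A B, hom (prod X A) B -> hom X (exp A B);
  ev_curry : forall X A B (f : hom (prod X A) B),
    ev A B ∘ pair (curry f ∘ pr1 X A) (pr2 X A) = f;
  curry_uniq : forall X A B (g h : hom X (exp A B)),
    ev A B ∘ pair (g ∘ pr1 X A) (pr2 X A) = ev A B ∘ pair (h ∘ pr1 X A) (pr2 X A) ->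
    g = h;

  Omega : topos_cat;
  truth : hom one Omega;
  chi : forall A X (m : hom A X), mono m -> hom X Omega;
  chi_pb : forall A X (m : hom A X) (Hm : mono m),
    is_pullback m (bang A) (chi Hm) truth;
  chi_uniq : forall A X (m : hom A X) (Hm : mono m) (f : hom X Omega),
    is_pullback m (bang A) f truth -> f = chi Hm
}.
Arguments one {t}.
Arguments bang {t} X.
Arguments prod {t} _ _.
Arguments pr1 {t} X Y.
Arguments pr2 {t} X Y.
Arguments pair {t W X Y} _ _.
Arguments eqz {t X Y} f g.
Arguments eqm {t X Y} f g.
Arguments eqz_lift {t X Y f g W h} _.
Arguments exp {t} _ _.
Arguments ev {t} A B.
Arguments curry {t X A B} _.
Arguments Omega {t}.
Arguments truth {t}.
Arguments chi {t A X m} Hm.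

Section ToposDefs.
Variable T : Topos.
Implicit Types X Y Z W A B : T.

Definition prod_map X Y X' Y' (f : hom X X') (g : hom Y Y') :
  hom (prod X Y) (prod X' Y') :=
  pair (f ∘ pr1 X Y) (g ∘ pr2 X Y).

Definition pb X Y Z (f : hom X Z) (g : hom Y Z) : T :=
  eqz (f ∘ pr1 X Y) (g ∘ pr2 X Y).
Definition pb1 X Y Z (f : hom X Z) (g : hom Y Z) : hom (pb f g) X :=
  pr1 X Y ∘ eqm (f ∘ pr1 X Y) (g ∘ pr2 X Y).
Definition pb2 X Y Z (f : hom X Z) (g : hom Y Z) : hom (pb f g) Y :=
  pr2 X Y ∘ eqm (f ∘ pr1 X Y) (g ∘ pr2 X Y).

Lemma pbP X Y Z (f : hom X Z) (g : hom Y Z) : is_pullback (pb1 f g) (pb2 f g) f g.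
Proof.
split; first by rewrite -!compA eqm_eq.
move=> W u v E.
have H : (f ∘ pr1 X Y) ∘ pair u v = (g ∘ pr2 X Y) ∘ pair u v.
  by rewrite !compA pr1_pair pr2_pair.
exists (eqz_lift H); split.
  by rewrite /pb1 /pb2 !compA eqz_liftK pr1_pair pr2_pair.
move=> w [E1 E2]; apply: eqm_mono; rewrite eqz_liftK; apply: pair_uniq.
  by rewrite pr1_pair -E1 /pb1 compA.
by rewrite pr2_pair -E2 /pb2 compA.
Qed.

Lemma mono_pb1 X Y Z (f : hom X Z) (g : hom Y Z) : mono g -> mono (pb1 f g).
Proof.
move=> Hg W u v E; have [E0 H] := pbP f g.
have E2 : pb2 f g ∘ u = pb2 f g ∘ v by
  apply: Hg; rewrite -(compA _ _ u) -(compA _ _ v) -E0 (compA _ _ u) (compA _ _ v) E.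
have [|w [_ U]] := H W (pb1 f g ∘ v) (pb2 f g ∘ v); first by rewrite -(compA _ _ v) E0 compA.
by rewrite -(U u) // -(U v).
Qed.

Lemma mono_from_one X (m : hom one X) : mono m.
Proof. by move=> W u v _; apply: bang_uniq. Qed.

Definition truth_at X : hom X Omega := truth ∘ bang X.

Definition meet : hom (prod Omega Omega) (@Omega T) :=
  chi (@mono_from_one _ (pair truth truth)).

End ToposDefs.
Arguments truth_at {T} X.
Arguments meet {T}.

Record LocalOperator (T : Topos) := {
  lop :> hom (@Omega T) Omega;
  lop_truth : lop ∘ truth = truth;
  lop_idem : lop ∘ lop = lop;
  lop_meet : lop ∘ meet = meet ∘ prod_map lop lop
}.

Section ToposTheory.
Variable T : Topos.
Implicit Types X Y Z W A B : T.

Lemma one_terminal : is_terminal (@one T).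
Proof. by move=> W; exists (bang W); split=> // f _; apply: bang_uniq. Qed.

Lemma prod_product X Y : is_product (pr1 X Y) (pr2 X Y).
Proof.
move=> W u v; exists (pair u v); split; first by rewrite pr1_pair pr2_pair.
move=> w [<- <-].
by apply: pair_uniq; rewrite ?pr1_pair ?pr2_pair.
Qed.

Lemma eqm_equalizer X Y (f g : hom X Y) : is_equalizer (eqm f g) f g.
Proof.
split; first exact: eqm_eq.
move=> W h H; exists (eqz_lift H); split; first exact: eqz_liftK.
by move=> w E; apply: eqm_mono; rewrite eqz_liftK E.
Qed.

Lemma pair_comp W V X Y (u : hom W X) (v : hom W Y) (h : hom V W) :
  pair u v ∘ h = pair (u ∘ h) (v ∘ h).
Proof. by apply: pair_uniq; rewrite -compA ?pr1_pair ?pr2_pair. Qed.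

Lemma pair_eta W X Y (u : hom W (prod X Y)) : u = pair (pr1 X Y ∘ u) (pr2 X Y ∘ u).
Proof. by apply: pair_uniq; rewrite ?pr1_pair ?pr2_pair. Qed.

Lemma truth_at_comp X Y (h : hom Y X) : truth_at X ∘ h = truth_at Y.
Proof. by rewrite /truth_at compA; congr (_ ∘ _); apply: bang_uniq. Qed.

Lemma truthE X (v : hom X one) : truth ∘ v = truth_at X.
Proof. by rewrite /truth_at; congr (_ ∘ _); apply: bang_uniq. Qed.

Lemma truth_at_one : truth_at one = @truth T.
Proof. by rewrite -(truthE (idm one)) compm1. Qed.

Lemma chi_truth A X (m : hom A X) (Hm : mono m) Y (h : hom Y X) :
  chi Hm ∘ h = truth_at Y <-> exists k, m ∘ k = h.
Proof.
have [E H] := chi_pb Hm; split.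
  by case/H=> k [[Ek _] _]; exists k.
by case=> k <-; rewrite -compA E compA truthE.
Qed.

Lemma pb_truth A X (m : hom A X) (f : hom X Omega) : mono m ->
  (forall Y (h : hom Y X), f ∘ h = truth_at Y <-> exists k, m ∘ k = h) ->
  is_pullback m (bang A) f truth.
Proof.
move=> Hm H; split; first by rewrite truthE; apply/H; exists (idm A); rewrite compm1.
move=> W u v; rewrite truthE => /H [k Ek]; exists k.
split; first by split=> //; apply: bang_uniq.
by move=> w [Ew _]; apply: Hm; rewrite Ek Ew.
Qed.

Lemma chi_unique A X (m : hom A X) (Hm : mono m) (f : hom X Omega) :
  (forall Y (h : hom Y X), f ∘ h = truth_at Y <-> exists k, m ∘ k = h) -> f = chi Hm.
Proof. by move=> H; apply: chi_uniq; apply: pb_truth. Qed.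

Definition sub X (f : hom X Omega) := eqm f (truth_at X).

Lemma subP X (f : hom X Omega) Y (h : hom Y X) :
  f ∘ h = truth_at Y <-> exists k, sub f ∘ k = h.
Proof.
split=> [E | [k <-]].
  have H : f ∘ h = truth_at X ∘ h by rewrite truth_at_comp.
  by exists (eqz_lift H); rewrite eqz_liftK.
by rewrite -compA eqm_eq !truth_at_comp.
Qed.

Lemma sub_truth X (f : hom X Omega) : f ∘ sub f = truth_at _.
Proof. by apply/subP; exists (idm _); rewrite compm1. Qed.

Lemma chi_sub X (f : hom X Omega) : f = chi (@eqm_mono _ _ _ f (truth_at X)).
Proof. by apply: chi_unique => Y h; apply: subP. Qed.

Lemma chi_equalizer A X (m : hom A X) (Hm : mono m) :
  is_equalizer m (chi Hm) (truth_at X).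
Proof.
split; first by rewrite truth_at_comp; apply/chi_truth; exists (idm A); rewrite compm1.
move=> W h; rewrite truth_at_comp => /chi_truth [k <-]; exists k.
by split=> // w E; apply: Hm.
Qed.

Lemma omega_ext X (f g : hom X Omega) :
  (forall Y (h : hom Y X), f ∘ h = truth_at Y <-> g ∘ h = truth_at Y) -> f = g.
Proof.
move=> H; rewrite (chi_sub f); symmetry; apply: chi_unique => Y h.
by rewrite -H; apply: subP.
Qed.

Lemma meet_truth X (f g : hom X Omega) :
  meet ∘ pair f g = truth_at X <-> f = truth_at X /\ g = truth_at X.
Proof.
rewrite /meet chi_truth; split=> [[k E] | [-> ->]].
  rewrite pair_comp !truthE in E.
  by rewrite -(pr1_pair f g) -{2}(pr2_pair f g) -E pr1_pair pr2_pair.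
by exists (bang X); rewrite pair_comp.
Qed.

Lemma meet_ext X (f g u : hom X Omega) :
  (forall Y (h : hom Y X), f ∘ h = truth_at Y /\ g ∘ h = truth_at Y <->
     u ∘ h = truth_at Y) -> meet ∘ pair f g = u.
Proof. by move=> H; apply: omega_ext => Y h; rewrite compA pair_comp meet_truth. Qed.

Lemma local_operator_meet (j : hom (@Omega T) Omega) :
  (forall X (f g : hom X Omega), j ∘ (meet ∘ pair f g) = truth_at X <->
     j ∘ f = truth_at X /\ j ∘ g = truth_at X) ->
  j ∘ meet = meet ∘ prod_map j j.
Proof.
move=> H; apply: omega_ext => Y h.
rewrite (pair_eta h) compA H compA /prod_map pair_comp meet_truth.
by rewrite !compA pr1_pair pr2_pair.
Qed.

Variable j : LocalOperator T.

Lemma lop_at X : j ∘ truth_at X = truth_at X.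
Proof. by rewrite /truth_at -compA lop_truth. Qed.

Lemma lop_pair X (f g : hom X Omega) :
  j ∘ (meet ∘ pair f g) = meet ∘ pair (j ∘ f) (j ∘ g).
Proof.
by rewrite -compA lop_meet compA /prod_map pair_comp !compA pr1_pair pr2_pair.
Qed.

Lemma lop_mono X (f g : hom X Omega) :
  (forall Y (h : hom Y X), f ∘ h = truth_at Y -> g ∘ h = truth_at Y) ->
  j ∘ f = truth_at X -> j ∘ g = truth_at X.
Proof.
move=> H E.
have M : meet ∘ pair f g = f.
  by apply: meet_ext => Y h; split=> [[]|E'] //; split=> //; apply: H.
by have := lop_pair f g; rewrite M E => /esym /meet_truth [].
Qed.

End ToposTheory.

Section Sheaves.
Variables (T : Topos) (j : LocalOperator T).
Implicit Types X Y Z W A B : T.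

(* The closure of [m] has characteristic arrow [j ∘ chi m]; density says that
   it is the maximal subobject. *)
Definition dense A X (m : hom A X) (Hm : mono m) := j ∘ chi Hm = truth_at X.

Definition is_sheaf B :=
  forall A X (m : hom A X) (Hm : mono m), dense Hm ->
  forall f : hom A B, exists! g : hom X B, g ∘ m = f.

Definition Omega_j : T := eqz (idm Omega) j.
Definition Omega_incl : hom Omega_j Omega := eqm (idm Omega) j.

Lemma sheaf_sep B : is_sheaf B -> forall A X (m : hom A X) (Hm : mono m), dense Hm ->
  forall u v : hom X B, u ∘ m = v ∘ m -> u = v.
Proof.
move=> HB A X m Hm D u v E; have [w [_ U]] := HB _ _ _ _ D (v ∘ m).
by rewrite -(U u) // -(U v).
Qed.

Lemma sheaf_intro B :
  (forall A X (m : hom A X) (Hm : mono m), dense Hm ->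
    (forall f : hom A B, exists g : hom X B, g ∘ m = f) /\
    (forall u v : hom X B, u ∘ m = v ∘ m -> u = v)) -> is_sheaf B.
Proof.
move=> H A X m Hm D f; have [He Hu] := H _ _ _ _ D; have [g E] := He f.
by exists g; split=> // g' E'; apply: Hu; rewrite E E'.
Qed.

Lemma sheaf_one : is_sheaf one.
Proof.
apply: sheaf_intro => A X m Hm D; split=> [f|u v _]; last exact: bang_uniq.
by exists (bang X); apply: bang_uniq.
Qed.

Lemma sheaf_prod A B : is_sheaf A -> is_sheaf B -> is_sheaf (prod A B).
Proof.
move=> HA HB; apply: sheaf_intro => C X m Hm D; split=> [f|u v E].
  have [g1 [E1 _]] := HA _ _ _ _ D (pr1 A B ∘ f).
  have [g2 [E2 _]] := HB _ _ _ _ D (pr2 A B ∘ f).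
  by exists (pair g1 g2); rewrite pair_comp E1 E2 -pair_eta.
by apply: pair_uniq; [apply: (sheaf_sep HA D) | apply: (sheaf_sep HB D)];
  rewrite !compA E.
Qed.

Lemma sheaf_eqz A B (f g : hom A B) : is_sheaf A -> is_sheaf B -> is_sheaf (eqz f g).
Proof.
move=> HA HB; apply: sheaf_intro => C X m Hm D; split=> [h|u v E].
  have [k [Ek _]] := HA _ _ _ _ D (eqm f g ∘ h).
  have H : f ∘ k = g ∘ k.
    by apply: (sheaf_sep HB D); rewrite !compA Ek -!compA eqm_eq.
  by exists (eqz_lift H); apply: eqm_mono; rewrite -compA eqz_liftK.
by apply: eqm_mono; apply: (sheaf_sep HA D); rewrite !compA E.
Qed.

Lemma mono_prod_map C X (m : hom C X) A : mono m -> mono (prod_map m (idm A)).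
Proof.
move=> Hm W u v E; apply: pair_uniq.
  apply: Hm; have := f_equal (fun z => pr1 _ _ ∘ z) E.
  by rewrite /prod_map -!compA pr1_pair !compA.
have := f_equal (fun z => pr2 _ _ ∘ z) E.
by rewrite /prod_map -!compA pr2_pair !compA !comp1m.
Qed.

Lemma dense_prod_map C X (m : hom C X) (Hm : mono m) A :
  dense Hm -> dense (@mono_prod_map C X m A Hm).
Proof.
move=> D; rewrite /dense.
rewrite -(chi_unique (@mono_prod_map C X m A Hm) (f := chi Hm ∘ pr1 X A)).
  by move=> Y h; rewrite compA chi_truth; split=> [[k E] | [k <-]];
    [exists (pair k (pr2 X A ∘ h)) | exists (pr1 C A ∘ k)];
    [ rewrite /prod_map pair_comp !compA pr1_pair pr2_pair E comp1m -pair_eta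
    | rewrite /prod_map -!compA pr1_pair ].
by rewrite -compA D truth_at_comp.
Qed.

Lemma curry_nat X Y A B (f : hom (prod X A) B) (h : hom Y X) :
  curry f ∘ h = curry (f ∘ prod_map h (idm A)).
Proof.
apply: curry_uniq; rewrite ev_curry -{2}(ev_curry f) /prod_map.
rewrite !compA pair_comp !compA pr1_pair pr2_pair comp1m.
by rewrite -compA.
Qed.

Lemma sheaf_exp A B : is_sheaf B -> is_sheaf (exp A B).
Proof.
move=> HB; apply: sheaf_intro => C X m Hm D; have D' := @dense_prod_map C X m Hm A D.
split=> [f|u v E].
  have [g [Eg _]] := HB _ _ _ _ D' (ev A B ∘ pair (f ∘ pr1 C A) (pr2 C A)).
  by exists (curry g); rewrite curry_nat Eg; apply: curry_uniq; rewrite ev_curry.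
apply: curry_uniq; apply: (sheaf_sep HB D').
rewrite !compA !pair_comp !compA /prod_map pr1_pair pr2_pair -!compA.
by rewrite E.
Qed.

Lemma Omega_incl_fix : j ∘ Omega_incl = Omega_incl.
Proof. by rewrite -{2}(comp1m Omega_incl) /Omega_incl eqm_eq. Qed.

Lemma lop_fixed_ext A X (m : hom A X) (Hm : mono m) (u v : hom X Omega) :
  dense Hm -> j ∘ u = u -> j ∘ v = v -> u ∘ m = v ∘ m -> u = v.
Proof.
have half (u' v' : hom X Omega) : dense Hm -> j ∘ u' = u' -> j ∘ v' = v' ->
    u' ∘ m = v' ∘ m -> forall Y (h : hom Y X), u' ∘ h = truth_at Y -> v' ∘ h = truth_at Y.
  move=> D Eu Ev E Y h Eh; rewrite -Ev compA.
  apply: (lop_mono (f := chi Hm ∘ h)); last by rewrite -compA D truth_at_comp.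
  move=> Z k; rewrite !compA => /chi_truth [l El].
  by rewrite -El -compA -E compA El -compA Eh truth_at_comp.
by move=> D Eu Ev E; apply: omega_ext => Y h; split; apply: half.
Qed.

Lemma sheaf_Omega_j : is_sheaf Omega_j.
Proof.
apply: sheaf_intro => A X m Hm D; split=> [f|u v E]; last first.
  apply: eqm_mono; apply: (lop_fixed_ext D); last by rewrite !compA E.
    by rewrite -compA Omega_incl_fix.
  by rewrite -compA Omega_incl_fix.
have Hs : mono (m ∘ sub (Omega_incl ∘ f)).
  by move=> W u v; rewrite !compA => E; apply: eqm_mono; apply: (Hm _ _ _ E).
have H : idm Omega ∘ (j ∘ chi Hs) = j ∘ (j ∘ chi Hs).
  by rewrite comp1m -compA lop_idem.
exists (eqz_lift H); apply: eqm_mono; rewrite -compA eqz_liftK compA.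
have -> : chi Hs ∘ m = Omega_incl ∘ f.
  apply: omega_ext => Y h; rewrite compA chi_truth (subP (Omega_incl ∘ f)).
  by split=> [[k E]|[k <-]]; exists k; rewrite ?compA //; apply: (Hm); rewrite -compA.
by rewrite -compA Omega_incl_fix.
Qed.

Definition sheaf_obj := {B : T | is_sheaf B}.

Definition sheaf_cat : Category := {|
  obj := sheaf_obj;
  hom := fun A B : sheaf_obj => hom (proj1_sig A) (proj1_sig B);
  idm := fun A : sheaf_obj => idm (proj1_sig A);
  comp := fun (A B C : sheaf_obj) g f => g ∘ f;
  comp1m := fun (A B : sheaf_obj) f => comp1m f;
  compm1 := fun (A B : sheaf_obj) f => compm1 f;
  compA := fun (A B C D : sheaf_obj) h g f => compA h g f
|}.

Definition sheaf_incl : Functor sheaf_cat T.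
Proof.
by refine {| fobj := fun A : sheaf_cat => proj1_sig A; fmap := fun (A B : sheaf_cat) f => f |}.
Defined.

Definition sh_one : sheaf_cat := exist _ one sheaf_one.
Definition sh_prod (A B : sheaf_cat) : sheaf_cat :=
  exist _ (prod (proj1_sig A) (proj1_sig B)) (sheaf_prod (proj2_sig A) (proj2_sig B)).
Definition sh_eqz (A B : sheaf_cat) (f g : hom A B) : sheaf_cat :=
  exist _ (@eqz T (proj1_sig A) (proj1_sig B) f g)
    (sheaf_eqz (proj2_sig A) (proj2_sig B)).
Definition sh_exp (A B : sheaf_cat) : sheaf_cat :=
  exist _ (exp (proj1_sig A) (proj1_sig B)) (sheaf_exp (proj2_sig B)).
Definition sh_Omega : sheaf_cat := exist _ Omega_j sheaf_Omega_j.

Lemma truth_j_eq : idm Omega ∘ truth = j ∘ truth.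
Proof. by rewrite comp1m lop_truth. Qed.

Definition truth_j : hom one Omega_j := eqz_lift truth_j_eq.

Lemma truth_jE : Omega_incl ∘ truth_j = truth.
Proof. exact: eqz_liftK. Qed.

Lemma sheaf_mono (A X : sheaf_cat) (m : hom A X) :
  mono m -> @mono T (proj1_sig A) (proj1_sig X) m.
Proof.
move=> Hm W u v E.
set f := (m : @hom T _ _) ∘ pr1 (proj1_sig A) (proj1_sig A).
set g := (m : @hom T _ _) ∘ pr2 (proj1_sig A) (proj1_sig A).
have Ek : pr1 _ _ ∘ eqm f g = pr2 _ _ ∘ eqm f g.
  apply: (Hm (@sh_eqz (sh_prod A A) X f g)).
  by have := eqm_eq f g; rewrite /f /g !compA.
have H : f ∘ pair u v = g ∘ pair u v by rewrite /f /g !compA pr1_pair pr2_pair.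
by rewrite -(pr1_pair u v) -{2}(pr2_pair u v) -(eqz_liftK H) -!compA Ek.
Qed.

Lemma sheaf_closed A X (m : hom A X) (Hm : mono m) :
  is_sheaf A -> is_sheaf X -> j ∘ chi Hm = chi Hm.
Proof.
move=> HA HX; apply: omega_ext => Y h; split=> E; last first.
  by rewrite compA E lop_at.
set n := sub (chi Hm ∘ h).
have D : dense (@eqm_mono _ _ _ (chi Hm ∘ h) (truth_at Y)).
  by rewrite /dense -chi_sub -compA.
have /chi_truth [k Ek] : chi Hm ∘ (h ∘ n) = truth_at _ by rewrite -compA sub_truth.
have [k' [Ek' _]] := HA _ _ _ _ D k.
apply/chi_truth; exists k'; apply: (sheaf_sep HX D).
by rewrite compA Ek' Ek.
Qed.

Lemma sh_chi_eq (A X : sheaf_cat) (m : hom A X) (Hm : mono m) :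
  idm Omega ∘ chi (sheaf_mono Hm) = j ∘ chi (sheaf_mono Hm).
Proof. by rewrite comp1m (sheaf_closed (sheaf_mono Hm) (proj2_sig A) (proj2_sig X)). Qed.

Definition sh_chi (A X : sheaf_cat) (m : hom A X) (Hm : mono m) : hom X sh_Omega :=
  eqz_lift (sh_chi_eq Hm).

Lemma sh_chi_pb (A X : sheaf_cat) (m : hom A X) (Hm : mono m) :
  @is_pullback sheaf_cat A X sh_one sh_Omega m (bang (proj1_sig A)) (sh_chi Hm) truth_j.
Proof.
have [E H] := chi_pb (sheaf_mono Hm).
split.
  by apply: eqm_mono; rewrite /= -!compA eqz_liftK truth_jE.
move=> W u v E'; apply: H.
have E'' : @comp T _ _ _ (sh_chi Hm) u = truth_j ∘ v by exact: E'.
by rewrite -truth_jE compA -E'' -compA eqz_liftK.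
Qed.

Lemma sh_chi_uniq (A X : sheaf_cat) (m : hom A X) (Hm : mono m) (f : hom X sh_Omega) :
  @is_pullback sheaf_cat A X sh_one sh_Omega m (bang (proj1_sig A)) f truth_j ->
  f = sh_chi Hm.
Proof.
move=> [E H]; apply: eqm_mono; rewrite eqz_liftK; apply: chi_unique => Y h; split.
  move=> Eh.
  set t : hom (proj1_sig X) Omega_j := truth_j ∘ bang (proj1_sig X).
  have Eh' : (f : @hom T _ _) ∘ h = t ∘ h.
    apply: eqm_mono; rewrite -[LHS]compA Eh /t [(_ ∘ _) ∘ h]compA -[RHS]compA.
    by rewrite truth_jE truthE.
  have [|k [[Ek _] _]] := H (@sh_eqz X sh_Omega f t) (eqm _ _) (bang _).
    have := eqm_eq (f : @hom T _ _) t; rewrite /= => ->.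
    by rewrite /t compA; congr (_ ∘ _); apply: bang_uniq.
  exists (@comp T _ _ _ k (eqz_lift Eh')); rewrite -compA.
  by rewrite (_ : @comp T _ _ _ m k = eqm _ _) ?eqz_liftK //; apply: Ek.
case=> k <-.
rewrite -[LHS]compA [X in X ∘ k]compA.
have E1 : @comp T _ _ _ f m = truth_j ∘ bang (proj1_sig A) by exact: E.
rewrite E1.
by rewrite -compA truth_jE truthE truth_at_comp.
Qed.

Definition sheaf_topos : Topos.
Proof.
refine {|
  topos_cat := sheaf_cat;
  one := sh_one;
  bang := fun A : sheaf_cat => bang (proj1_sig A);
  prod := sh_prod;
  pr1 := fun A B : sheaf_cat => pr1 (proj1_sig A) (proj1_sig B);
  pr2 := fun A B : sheaf_cat => pr2 (proj1_sig A) (proj1_sig B);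
  pair := fun (W A B : sheaf_cat) u v =>
    @pair T (proj1_sig W) (proj1_sig A) (proj1_sig B) u v;
  eqz := sh_eqz;
  eqm := fun (A B : sheaf_cat) f g => @eqm T (proj1_sig A) (proj1_sig B) f g;
  eqz_lift := fun (A B : sheaf_cat) f g (W : sheaf_cat) h H =>
    @eqz_lift T (proj1_sig A) (proj1_sig B) f g (proj1_sig W) h H;
  exp := sh_exp;
  ev := fun A B : sheaf_cat => ev (proj1_sig A) (proj1_sig B);
  curry := fun (X A B : sheaf_cat) f =>
    @curry T (proj1_sig X) (proj1_sig A) (proj1_sig B) f;
  Omega := sh_Omega;
  truth := truth_j;
  chi := sh_chi;
  chi_pb := sh_chi_pb;
  chi_uniq := sh_chi_uniq
|}.
- by move=> X f g; apply: bang_uniq.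
- by move=> W X Y u v; apply: pr1_pair.
- by move=> W X Y u v; apply: pr2_pair.
- by move=> W X Y u v; apply: pair_uniq.
- by move=> X Y f g; apply: eqm_eq.
- by move=> X Y f g W h H; apply: eqz_liftK.
- by move=> X Y f g W u v; apply: eqm_mono.
- by move=> X A B f; apply: ev_curry.
- by move=> X A B g h; apply: curry_uniq.
Defined.

End Sheaves.

(* [GeometricInclusion F E] is the type of inclusions [F -> E]. *)
Record GeometricInclusion (F E : Topos) := {
  direct : Functor F E;
  inverse : Functor E F;
  unit : forall X : E, hom X (direct (inverse X));
  unit_nat : forall (X Y : E) (f : hom X Y),
    unit Y ∘ f = fmap direct (fmap inverse f) ∘ unit X;
  counit : forall A : F, hom (inverse (direct A)) A;
  counit_nat : forall (A B : F) (f : hom A B),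
    counit B ∘ fmap inverse (fmap direct f) = f ∘ counit A;
  triangle_inverse : forall X : E,
    counit (inverse X) ∘ fmap inverse (unit X) = idm (inverse X);
  triangle_direct : forall A : F,
    fmap direct (counit A) ∘ unit (direct A) = idm (direct A);
  inverse_lex : preserves_finite_limits inverse;
  direct_ff : fully_faithful direct
}.
Arguments direct {F E} _.
Arguments inverse {F E} _.
Arguments unit {F E} _ X.
Arguments counit {F E} _ A.

Definition inclusion_comp (E F F' : Topos)
  (i : GeometricInclusion F E) (i' : GeometricInclusion F' F) : GeometricInclusion F' E.
Proof.
refine {|
  direct := functor_comp (direct i) (direct i');
  inverse := functor_comp (inverse i') (inverse i);
  unit := fun X => fmap (direct i) (unit i' (inverse i X)) ∘ unit i X;
  counit := fun A => counit i' A ∘ fmap (inverse i') (counit i (direct i' A))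
|}.
- by move=> X Y f; rewrite compA unit_nat /= -!compA -!fmapM unit_nat.
- by move=> A B f; rewrite /= compA -fmapM counit_nat fmapM -!compA counit_nat.
- move=> X; rewrite /= compA -fmapM.
  have -> : counit i _ ∘ fmap (inverse i) (fmap (direct i) (unit i' (inverse i X)) ∘ unit i X)
      = unit i' (inverse i X).
    by rewrite fmapM -compA counit_nat compA triangle_inverse compm1.
  exact: triangle_inverse.
- move=> A; rewrite /= -compA -fmapM.
  have -> : fmap (direct i') (counit i' A ∘ fmap (inverse i') (counit i (direct i' A)))
      ∘ unit i' _ = counit i (direct i' A).
    by rewrite fmapM compA -unit_nat -compA triangle_direct comp1m.
  by rewrite triangle_direct.
- split=> [X H|P X Y p q H|P X Y e f g H] /=.
  + by do 2 apply: (pres_terminal (inverse_lex _)).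
  + by do 2 apply: (pres_product (inverse_lex _)).
  + by do 2 apply: (pres_equalizer (inverse_lex _)).
- move=> A B g; have [f [Ef Uf]] := direct_ff g; have [f' [Ef' Uf']] := direct_ff f.
  exists f'; split; first by rewrite /= Ef'.
  by move=> h Eh; apply: Uf'; rewrite (Uf _ Eh).
Defined.

Lemma lex_of_chosen (T : Topos) (C : Category) (G : Functor T C) :
  is_terminal (G one) ->
  (forall X Y : T, is_product (fmap G (pr1 X Y)) (fmap G (pr2 X Y))) ->
  (forall (X Y : T) (f g : hom X Y), is_equalizer (fmap G (eqm f g)) (fmap G f) (fmap G g)) ->
  preserves_finite_limits G.
Proof.
move=> H1 H2 H3; split.
- move=> X HX W; have [w [_ Uw]] := H1 W; have [b [_ _]] := HX one.
  exists (fmap G b ∘ w); split=> // u _.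
  have E : b ∘ bang X = idm X by apply: (exists_unique_eq (HX X)).
  by rewrite (Uw (fmap G (bang X) ∘ u)) // -compA -fmapM E fmap1 comp1m.
- move=> P X Y p q H W u v.
  have [b [[Eb1 Eb2] _]] := H _ (pr1 X Y) (pr2 X Y).
  have E : b ∘ pair p q = idm P.
    apply: (exists_unique_eq (H P p q)); last by rewrite !compm1.
    by rewrite -!compA Eb1 Eb2 pr1_pair pr2_pair.
  have [w [[Ew1 Ew2] Uw]] := H2 X Y W u v.
  exists (fmap G b ∘ w); split; first by rewrite -!compA -!fmapM Eb1 Eb2.
  move=> w' [Ew1' Ew2']; rewrite (Uw (fmap G (pair p q) ∘ w')).
    by rewrite -!compA -!fmapM pr1_pair pr2_pair.
  by rewrite -compA -fmapM E fmap1 comp1m.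
- move=> P X Y e f g [H0 H].
  have [b [Eb _]] := H _ (eqm f g) (eqm_eq f g).
  have E : b ∘ eqz_lift H0 = idm P.
    apply: (exists_unique_eq (H P e H0)); last by rewrite compm1.
    by rewrite -compA Eb eqz_liftK.
  split; first by rewrite -!fmapM H0.
  have [_ H3'] := H3 _ _ f g.
  move=> W h /H3' [w [Ew Uw]].
  exists (fmap G b ∘ w); split; first by rewrite -compA -fmapM Eb.
  move=> w' Ew'; rewrite (Uw (fmap G (eqz_lift H0) ∘ w')).
    by rewrite -compA -fmapM eqz_liftK.
  by rewrite -compA -fmapM E fmap1 comp1m.
Qed.

Section EqualizerFacts.
Variables (C : Category) (P X Y : C) (e : hom P X) (f g : hom X Y).

Lemma equalizer_mono : is_equalizer e f g -> mono e.
Proof.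
move=> [E H] W u v Eu; have [|w [_ U]] := H W (e ∘ v).
  by rewrite -!compA E.
by rewrite -(U u) // -(U v).
Qed.

Lemma equalizer_iso : is_equalizer e f g -> (f = g <-> is_iso e).
Proof.
move=> He; have Hm := equalizer_mono He; have [E H] := He; split=> [Efg|[k [_ Ek]]].
  have [|k [Ek _]] := H X (idm X); first by rewrite Efg.
  by exists k; split=> //; apply: Hm; rewrite -compA Ek comp1m compm1.
by rewrite -(compm1 f) -(compm1 g) -Ek -!compA E.
Qed.

End EqualizerFacts.

Section Inclusion.
Variables (F E : Topos) (i : GeometricInclusion F E).
Notation L := (inverse i).
Notation D := (direct i).

Lemma adj_ext (X : E) (A : F) (g g' : hom (L X) A) :
  fmap D g ∘ unit i X = fmap D g' ∘ unit i X -> g = g'.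
Proof.
have H (h : hom (L X) A) : counit i A ∘ fmap L (fmap D h ∘ unit i X) = h.
  by rewrite fmapM -compA counit_nat compA triangle_inverse compm1.
by move=> E0; rewrite -(H g) -(H g') E0.
Qed.

Lemma adj_transpose (X : E) (A : F) (f : hom X (D A)) :
  fmap D (counit i A ∘ fmap L f) ∘ unit i X = f.
Proof. by rewrite fmapM compA -unit_nat -compA triangle_direct comp1m. Qed.

Lemma mono_direct (A B : F) (m : hom A B) : mono m -> mono (fmap D m).
Proof.
move=> Hm W u v; rewrite -(adj_transpose u) -(adj_transpose v) -!compA -!fmapM.
by move=> E0; rewrite (Hm _ _ _ (adj_ext E0)).
Qed.

Lemma inverse_equalizer (X A : E) (m : hom A X) (Hm : mono m) :
  is_equalizer (fmap L m) (fmap L (chi Hm)) (fmap L (truth_at X)).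
Proof. by apply: (pres_equalizer (inverse_lex i)); apply: chi_equalizer. Qed.

Lemma mono_inverse (X A : E) (m : hom A X) : mono m -> mono (fmap L m).
Proof. by move=> Hm; apply: equalizer_mono (inverse_equalizer Hm). Qed.

Lemma inverse_one_ext (Z : F) (u v : hom Z (L one)) : u = v.
Proof.
have [w [_ U]] := pres_terminal (inverse_lex i) (@one_terminal E) Z.
by rewrite -(U u) // -(U v).
Qed.

Lemma counit_iso (A : F) : is_iso (counit i A).
Proof.
have [d [Ed _]] := direct_ff (unit i (D A)); exists d; split.
  by apply: adj_ext; rewrite fmapM compA triangle_direct compm1 Ed fmap1 comp1m.
apply: (exists_unique_eq (direct_ff (fmap D (idm A)))) => //.
by rewrite fmapM Ed triangle_direct fmap1.
Qed.

(* The universal closure operation on subobjects of [E] induced by [L]. *)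
Definition closure (A X : E) (m : hom A X) : hom (pb (unit i X) (fmap D (fmap L m))) X :=
  pb1 (unit i X) (fmap D (fmap L m)).

Lemma mono_closure (A X : E) (m : hom A X) : mono m -> mono (closure m).
Proof. by move=> Hm; apply: mono_pb1; apply: mono_direct; apply: mono_inverse. Qed.

(* The local operator corresponding to a universal closure operation is the
   characteristic arrow of the closure of [truth]. *)
Definition inclusion_lop : hom (@Omega E) Omega :=
  chi (mono_closure (@mono_from_one _ _ truth)).

Lemma inclusion_lop_truth (X : E) (f : hom X Omega) :
  inclusion_lop ∘ f = truth_at X <-> fmap L f = fmap L (truth_at X).
Proof.
rewrite /inclusion_lop chi_truth /closure.
have [E0 H] := pbP (unit i Omega) (fmap D (fmap L truth)).
have nat (g : hom X Omega) : fmap D (fmap L g) ∘ unit i X = unit i Omega ∘ g.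
  by rewrite unit_nat.
split=> [[k Ek]|Ef].
  apply: adj_ext; rewrite nat -Ek -compA E0 compA.
  rewrite -(adj_transpose (pb2 _ _ ∘ k)) -compA.
  by rewrite (inverse_one_ext (_ ∘ _) (fmap L (bang X))) -!fmapM.
have [|k [[Ek _] _]] := H X f (fmap D (fmap L (bang X)) ∘ unit i X).
  by rewrite -nat Ef /truth_at !fmapM compA.
by exists k.
Qed.

Lemma inverse_sub_iso (X : E) (f : hom X Omega) :
  fmap L f = fmap L (truth_at X) <-> is_iso (fmap L (sub f)).
Proof.
by apply: equalizer_iso; apply: (pres_equalizer (inverse_lex i)); apply: eqm_equalizer.
Qed.

Lemma iso_epi (C : Category) (X Y Z : C) (m : hom X Y) (u v : hom Y Z) :
  is_iso m -> u ∘ m = v ∘ m -> u = v.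
Proof.
by move=> [k [_ Ek]] E0; rewrite -(compm1 u) -(compm1 v) -Ek -!compA E0.
Qed.

Definition local_operator_of : LocalOperator E.
Proof.
refine {| lop := inclusion_lop |}.
- by rewrite -truth_at_one; apply/inclusion_lop_truth.
- apply: omega_ext => X f; rewrite compA !inclusion_lop_truth; split=> H.
    move/inverse_sub_iso: (H) => Hn; apply: (iso_epi Hn).
    rewrite -!fmapM truth_at_comp; apply/inclusion_lop_truth.
    by rewrite -compA sub_truth.
  by move/inclusion_lop_truth: H => ->.
- apply: local_operator_meet => X f g; rewrite !inclusion_lop_truth; split=> [H|[Hf Hg]].
    move/inverse_sub_iso: (H) => Hn; have := sub_truth (meet ∘ pair f g).
    rewrite compA pair_comp meet_truth => -[Ef Eg].
    by split; apply: (iso_epi Hn); rewrite -!fmapM ?Ef ?Eg truth_at_comp.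
  have <- : meet ∘ pair (truth_at X) (truth_at X) = truth_at X by apply/meet_truth.
  rewrite !fmapM; congr (_ ∘ _).
  refine (exists_unique_eq (pres_product (inverse_lex i) (@prod_product E Omega Omega)
    (fmap L (truth_at X)) (fmap L (truth_at X))) _ _).
    by rewrite -!fmapM pr1_pair pr2_pair.
  by rewrite -!fmapM pr1_pair pr2_pair.
Defined.

Lemma dense_iso (A X : E) (m : hom A X) (Hm : mono m) :
  dense local_operator_of Hm <-> is_iso (fmap L m).
Proof.
rewrite /dense /= inclusion_lop_truth.
exact: equalizer_iso (inverse_equalizer Hm).
Qed.

Lemma sheaf_direct (A : F) : is_sheaf local_operator_of (D A).
Proof.
apply: sheaf_intro => B X m Hm /dense_iso Hd; split=> [f|u v E0].
  have [k [Ek _]] := Hd.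
  exists (fmap D (counit i A ∘ fmap L f ∘ k) ∘ unit i X).
  by rewrite compA unit_nat -compA -fmapM compA Ek compm1 adj_transpose.
rewrite -(adj_transpose u) -(adj_transpose v); suff -> : fmap L u = fmap L v by [].
by apply: (iso_epi Hd); rewrite -!fmapM E0.
Qed.

Definition sheaf_direct_functor : Functor F (sheaf_topos local_operator_of).
Proof.
refine {| fobj := fun A => exist _ (D A) (@sheaf_direct A) : sheaf_topos local_operator_of;
          fmap := fun A B f => fmap D f |}.
- by move=> A; apply: fmap1.
- by move=> A B C g f; apply: fmapM.
Defined.

Definition sheaf_inclusion : GeometricInclusion F (sheaf_topos local_operator_of).
Proof.
refine {|
  direct := sheaf_direct_functor;
  inverse := functor_comp L (sheaf_incl local_operator_of);
  unit := fun X : sheaf_topos local_operator_of => unit i (proj1_sig X);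
  counit := counit i
|}.
- by move=> X Y f; apply: unit_nat.
- by move=> A B f; apply: counit_nat.
- by move=> X; apply: triangle_inverse.
- by move=> A; apply: triangle_direct.
- apply: lex_of_chosen => [|X Y|X Y f g].
  + exact: (pres_terminal (inverse_lex i) (@one_terminal E)).
  + exact: (pres_product (inverse_lex i) (@prod_product E _ _)).
  + exact: (pres_equalizer (inverse_lex i) (@eqm_equalizer E _ _ _ _)).
- by move=> A B g; apply: direct_ff.
Defined.

Lemma sheaf_unit_iso (X : sheaf_topos local_operator_of) : is_iso (unit sheaf_inclusion X).
Proof.
case: X => Y HY /=.
have Hm : mono (unit i Y).
  move=> W u v E0.
  have EL : fmap L u = fmap L v by apply: adj_ext; rewrite -!unit_nat E0.
  have Hd : dense local_operator_of (@eqm_mono _ _ _ u v).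
    apply/dense_iso/equalizer_iso; last exact: EL.
    by apply: (pres_equalizer (inverse_lex i)); apply: eqm_equalizer.
  by apply: (sheaf_sep HY Hd); apply: eqm_eq.
have Hd : dense local_operator_of Hm.
  apply/dense_iso; have [k [Ek Ek']] := counit_iso (L Y).
  have E0 := triangle_inverse i Y.
  have Ek2 : fmap L (unit i Y) = k.
    by rewrite -[LHS]comp1m -Ek compA E0 compm1.
  by exists (counit i (L Y)); split=> //; rewrite Ek2.
have [r [Er _]] := HY _ _ _ _ Hd (idm Y); exists r; split=> //=.
by apply: (sheaf_sep (@sheaf_direct (L Y)) Hd); rewrite compA Er comp1m compm1.
Qed.

End Inclusion.

(* The counit is invertible as well, since the direct image is fully faithful. *)
Record ToposEquivalence (F S : Topos) := {
  eqv :> GeometricInclusion F S;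
  eqv_unit_iso : forall X : S, is_iso (unit eqv X)
}.

(* The direct image of [i], corestricted to sheaves. *)
Definition sheaf_equivalence (F E : Topos) (i : GeometricInclusion F E) :
  ToposEquivalence F (sheaf_topos (local_operator_of i)) :=
  {| eqv := sheaf_inclusion i; eqv_unit_iso := @sheaf_unit_iso F E i |}.

Section Transport.
Variables (F S : Topos) (K : ToposEquivalence F S).
Notation L := (inverse K).
Notation D := (direct K).

(* The canonical isomorphism between the subobject classifier of [F] and that
   of [S]: it classifies the image of [truth]. *)
Definition omega_iso : hom (D Omega) (@Omega S) :=
  chi (mono_direct (i := K) (@mono_from_one F _ truth)).

(* The transpose of [omega_iso_inv] under the adjunction. *)
Definition omega_mate : hom (L Omega) (@Omega F) :=
  chi (mono_inverse (i := K) (@mono_from_one S _ truth)).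

Definition omega_iso_inv : hom (@Omega S) (D Omega) :=
  fmap D omega_mate ∘ unit K Omega.

Lemma counit_truth (Z : F) (y : hom Z Omega) :
  y ∘ counit K Z = truth_at _ <-> y = truth_at Z.
Proof.
split=> [E0|->]; last exact: truth_at_comp.
by apply: (iso_epi (counit_iso K Z)); rewrite E0 truth_at_comp.
Qed.

Lemma omega_iso_truth (Y : S) (x : hom Y (D Omega)) (y : hom (L Y) Omega) :
  fmap D y ∘ unit K Y = x -> (omega_iso ∘ x = truth_at Y <-> y = truth_at (L Y)).
Proof.
move=> E0; rewrite /omega_iso chi_truth; split=> [[k Ek]|Ey].
  rewrite -(truthE (counit K one ∘ fmap L k)); apply: (adj_ext (i := K)).
  by rewrite E0 -Ek fmapM compA adj_transpose.
exists (fmap D (bang (L Y)) ∘ unit K Y).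
by rewrite -compA -fmapM truthE -Ey.
Qed.

Lemma omega_mate_truth (X : S) (f : hom X Omega) :
  omega_mate ∘ fmap L f = truth_at (L X) <-> f = truth_at X.
Proof.
rewrite /omega_mate chi_truth; split=> [[k Ek]|->]; last first.
  by exists (fmap L (bang X)); rewrite -fmapM.
have EL : fmap L f = fmap L (truth_at X).
  by rewrite -Ek (inverse_one_ext k (fmap L (bang X))) -fmapM.
have [r [Er _]] := eqv_unit_iso K Omega.
by rewrite -(comp1m f) -(comp1m (truth_at X)) -Er !compA !unit_nat EL.
Qed.

Lemma omega_iso_invE (X : S) (f : hom X Omega) :
  fmap D (omega_mate ∘ fmap L f) ∘ unit K X = omega_iso_inv ∘ f.
Proof. by rewrite /omega_iso_inv fmapM !compA unit_nat. Qed.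

Lemma inverse_lift (X : S) (Z : F) (h : hom Z (L X)) :
  exists h' : hom (D Z) X, fmap L h' = h ∘ counit K Z /\ unit K X ∘ h' = fmap D h.
Proof.
have [r [_ Er]] := eqv_unit_iso K X; exists (r ∘ fmap D h).
have E0 : unit K X ∘ (r ∘ fmap D h) = fmap D h by rewrite -compA Er comp1m.
split=> //; apply: (adj_ext (i := K)).
by rewrite -unit_nat E0 fmapM compA triangle_direct compm1.
Qed.

Lemma omega_isoK : omega_iso ∘ omega_iso_inv = idm Omega.
Proof.
apply: omega_ext => X f; rewrite compA comp1m.
by rewrite (omega_iso_truth (omega_iso_invE f)) omega_mate_truth.
Qed.

Lemma omega_iso_mono : mono omega_iso.
Proof.
move=> W u v E0; rewrite -(adj_transpose u) -(adj_transpose v).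
set yu := _ ∘ fmap L u; set yv := _ ∘ fmap L v.
suff -> : yu = yv by [].
apply: omega_ext => Z h; have [h' [_ Eh]] := inverse_lift h.
have key (y : hom (L W) Omega) :
    omega_iso ∘ (fmap D y ∘ unit K W ∘ h') = truth_at _ <-> y ∘ h = truth_at Z.
  rewrite -counit_truth; apply: omega_iso_truth.
  by rewrite fmapM compA triangle_direct compm1 fmapM compA Eh.
rewrite -(key yu) -(key yv) /yu /yv (adj_transpose u) (adj_transpose v).
by rewrite -(compA _ u) -(compA _ v) E0.
Qed.

Lemma omega_iso_invK : omega_iso_inv ∘ omega_iso = idm (D Omega).
Proof. by apply: omega_iso_mono; rewrite -compA omega_isoK comp1m compm1. Qed.

(* A local operator on [F], read as an arrow on the subobject classifier of [S]
   through [omega_iso]. *)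
Definition transport_lop (k : hom (@Omega F) Omega) : hom (@Omega S) Omega :=
  omega_iso ∘ fmap D k ∘ omega_iso_inv.

Lemma transport_lop_truth (k : hom (@Omega F) Omega) (X : S) (f : hom X Omega) :
  transport_lop k ∘ f = truth_at X <->
  k ∘ (omega_mate ∘ fmap L f) = truth_at (L X).
Proof.
rewrite /transport_lop (compA _ omega_iso_inv f) (compA _ (fmap D k)).
apply: omega_iso_truth.
by rewrite fmapM compA omega_iso_invE.
Qed.

Lemma omega_mate_meet (X : S) (f g : hom X Omega) :
  omega_mate ∘ fmap L (meet ∘ pair f g) =
  meet ∘ pair (omega_mate ∘ fmap L f) (omega_mate ∘ fmap L g).
Proof.
apply: omega_ext => Z h; have [h' [Eh _]] := inverse_lift h.
have key (x : hom X Omega) : omega_mate ∘ fmap L x ∘ h = truth_at _ <-> x ∘ h' = truth_at _.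
  by rewrite -counit_truth !compA -Eh -fmapM omega_mate_truth.
by rewrite key !compA !pair_comp !meet_truth !key.
Qed.

Definition transport (k : LocalOperator F) : LocalOperator S.
Proof.
refine {| lop := transport_lop k |}.
- rewrite -truth_at_one transport_lop_truth.
  have /omega_mate_truth -> : truth_at one = truth_at (@one S) by [].
  exact: lop_at.
- rewrite /transport_lop -[LHS]compA; congr (_ ∘ omega_iso_inv).
  rewrite -[LHS]compA (compA _ omega_iso_inv omega_iso) omega_iso_invK compm1.
  by rewrite compA -fmapM lop_idem.
- apply: local_operator_meet => X f g.
  by rewrite !transport_lop_truth omega_mate_meet lop_pair meet_truth.
Defined.

End Transport.

Definition is_relativization (T : Topos) (j k : LocalOperator T)
    (k' : LocalOperator (sheaf_topos j)) : Prop :=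
  Omega_incl j ∘ (k' : hom (Omega_j j) (Omega_j j)) = (k : hom Omega Omega) ∘ Omega_incl j.
Arguments is_relativization {T} j k k'.

(* Main.v *)
From Stdlib Require Import ssreflect Setoid.
Require Import Defs.

Set Implicit Arguments.
Unset Strict Implicit.
Unset Printing Implicit Defensive.

(** Both sides are tested on generalized elements of [Ω_L] at an arbitrary object
    [X] of [E], not only at sheaves. As [Ω_L] is isomorphic to [i_* Ω_F], such
    an element is the transpose of some [y : L X -> Ω_F]; its composite [χ] with
    [e : Ω_L -> Ω] classifies a subobject of [X] whose image under [L] is the
    subobject of [L X] classified by [y]. Since [L'] preserves equalizers, [L' y]
    is true iff [L'] inverts that image, that is, iff [L' (L χ)] is true. *)

Section DirectTruth.
Variables (F E : Topos) (i : GeometricInclusion F E).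
Notation L := (inverse i).
Notation D := (direct i).

(** [Omega_incl] up to the isomorphism of [D Omega] with [Omega_j], but written in [E] so that it
    applies at objects that are not sheaves. *)
Definition direct_truth_chi : hom (D Omega) (@Omega E) :=
  chi (mono_direct (i := i) (@mono_from_one F _ truth)).

Definition transpose_chi (X : E) (y : hom (L X) Omega) : hom X Omega :=
  direct_truth_chi ∘ (fmap D y ∘ unit i X).

Lemma transpose_chi_truth (X : E) (y : hom (L X) Omega) :
  transpose_chi y = truth_at X <-> y = truth_at (L X).
Proof.
rewrite /transpose_chi /direct_truth_chi chi_truth; split=> [[k Ek]|->].
  rewrite -(truthE (counit i one ∘ fmap L k)); apply: (adj_ext (i := i)).
  by rewrite -Ek fmapM compA adj_transpose.
exists (fmap D (bang (L X)) ∘ unit i X).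
by rewrite -compA -fmapM truthE.
Qed.

Lemma transpose_chi_comp (X Y : E) (y : hom (L X) Omega) (h : hom Y X) :
  transpose_chi y ∘ h = transpose_chi (y ∘ fmap L h).
Proof. by rewrite /transpose_chi fmapM !compA unit_nat. Qed.

(** By a triangle identity [fmap L (unit i X)] is a right inverse of the counit, which is invertible
    because [D] is fully faithful. *)
Lemma inverse_unitK (X : E) : fmap L (unit i X) ∘ counit i (L X) = idm _.
Proof.
apply: (iso_epi (m := fmap L (unit i X))).
  have [k [Ek Ek']] := counit_iso i (L X).
  have <- : k = fmap L (unit i X).
    by rewrite -[RHS]comp1m -Ek compA triangle_inverse compm1.
  by exists (counit i (L X)).
by rewrite compA triangle_inverse compm1 comp1m.
Qed.

Lemma inverse_sub_transpose_chi (X : E) (y : hom (L X) Omega) :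
  is_equalizer (fmap L (sub (transpose_chi y))) y (truth_at (L X)).
Proof.
split.
  rewrite truth_at_comp; apply/transpose_chi_truth.
  by rewrite -transpose_chi_comp sub_truth.
have [_ H] := pres_equalizer (inverse_lex i)
  (eqm_equalizer (transpose_chi y) (truth_at X)).
move=> Z h; rewrite truth_at_comp => Eh; apply: H.
(* Precomposing with the invertible counit turns [fmap L (unit i X) ∘ h] into [fmap L (fmap D h)],
   so that [y ∘ h] appears under [D], where the hypothesis on [h] applies. *)
apply: (iso_epi (counit_iso i Z)).
have Eu : fmap L (unit i X) ∘ (h ∘ counit i Z) = fmap L (fmap D h).
  by rewrite -counit_nat -compA inverse_unitK comp1m.
have Et : direct_truth_chi ∘ fmap D (truth_at Z) = truth_at (D Z).
  by apply/chi_truth; exists (fmap D (bang Z)); rewrite -fmapM.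
rewrite !compA {1}/transpose_chi !fmapM !compA Eu -!fmapM Eh Et /truth_at !fmapM.
by congr (_ ∘ _); apply: (inverse_one_ext (i := i)).
Qed.

(** Classifying arrows of sheaves are lifts along [Omega_incl] of those in [E]; the two sides then
    classify the same mono. *)
Lemma Omega_incl_omega_iso :
  Omega_incl (local_operator_of i) ∘
    (omega_iso (sheaf_equivalence i) : @hom E (D Omega) (Omega_j (local_operator_of i)))
  = direct_truth_chi.
Proof.
rewrite /omega_iso /= /sh_chi /Omega_incl eqz_liftK.
by apply: chi_unique => Y h; apply: chi_truth.
Qed.

End DirectTruth.

Lemma inclusion_comp_lop_truth (E F F' : Topos)
    (i : GeometricInclusion F E) (i' : GeometricInclusion F' F)
    (X : E) (y : hom (inverse i X) Omega) :
  inclusion_lop (inclusion_comp i i') ∘ transpose_chi y = truth_at X <->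
  inclusion_lop i' ∘ y = truth_at (inverse i X).
Proof.
rewrite !inclusion_lop_truth (inverse_sub_iso (inclusion_comp i i')) /=.
symmetry; apply: equalizer_iso; apply: (pres_equalizer (inverse_lex i')).
exact: inverse_sub_transpose_chi.
Qed.

Theorem proposition6p4 (E F F' : Topos)
    (i : GeometricInclusion F E) (i' : GeometricInclusion F' F) :
  is_relativization (local_operator_of i)
    (local_operator_of (inclusion_comp i i'))
    (transport (sheaf_equivalence i) (local_operator_of i')).
Proof.
rewrite /is_relativization; apply: omega_ext => X f.
(* Arrows of sheaves are arrows of [E], so the isomorphism and its inverse are retyped there and can
   be composed with [f], whose domain need not be a sheaf. *)
set w : @hom E (direct i Omega) (Omega_j (local_operator_of i)) :=
  omega_iso (sheaf_equivalence i).
set v : @hom E (Omega_j (local_operator_of i)) (direct i Omega) :=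
  omega_iso_inv (sheaf_equivalence i).
have wK : @comp E _ _ _ w v = idm _ := omega_isoK (sheaf_equivalence i).
have Ew : Omega_incl _ ∘ w = direct_truth_chi i := Omega_incl_omega_iso i.
have -> : transport (sheaf_equivalence i) (local_operator_of i') =
    @comp E _ _ _ (w ∘ fmap (direct i) (inclusion_lop i')) v :> @hom E _ _ by [].
clearbody w v.
set y := counit i Omega ∘ fmap (inverse i) (v ∘ f).
have Ev : v ∘ f = fmap (direct i) y ∘ unit i X by rewrite adj_transpose.
have Ef : f = w ∘ (fmap (direct i) y ∘ unit i X) by rewrite -Ev -compA wK comp1m.
have -> : Omega_incl _ ∘ (w ∘ fmap (direct i) (inclusion_lop i') ∘ v) ∘ f =
    transpose_chi (inclusion_lop i' ∘ y).
  by rewrite /transpose_chi -Ew fmapM !compA Ev.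
have -> : local_operator_of (inclusion_comp i i') ∘ Omega_incl _ ∘ f =
    inclusion_lop (inclusion_comp i i') ∘ transpose_chi y.
  by rewrite {1}Ef /transpose_chi -Ew !compA.
by rewrite inclusion_comp_lop_truth transpose_chi_truth.
Qed.
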